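(* Let $G$ be a graph on $n$ vertices with no isolated vertices that satisfies both of the following conditions: (a) for every edge $uv$ of $G$, $d_G(u)+d_G(v)\ge 4$; (b) no two vertices of degree $1$ in $G$ are at distance exactly $4$ in $G$. Then $\gamma_{\rm tg}(G)\le \frac{3}{4}n$.
   Context: For a graph $G$ without isolated vertices, a vertex $x$ totally dominates a vertex $y$ if $x$ and $y$ are adjacent. The total domination game on $G$ is played by two players, Dominator and Staller, who alternately choose vertices of $G$, Dominator choosing first. A vertex may be chosen only if it totally dominates at least one vertex that is not totally dominated by the previously chosen vertices. The game ends when the set of chosen vertices is a total dominating set of $G$, i.e. every vertex of $G$ has a neighbor among the chosen vertices. Dominator wants to minimize the number of chosen vertices and Staller wants to maximize it. The game total domination number $\gamma_{\rm tg}(G)$ is the number of vertices chosen when Dominator starts and both players play optimally. A leaf is a vertex of degree $1$. *)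

(* Defs.v *)
From mathcomp Require Import all_boot.
Set Implicit Arguments. Unset Strict Implicit. Unset Printing Implicit Defensive.

Section TDG.
Variables (T : finType) (e : rel T).

Definition simple_graph := symmetric e /\ irreflexive e.

Definition nbhd (v : T) : {set T} := [set y | e v y].
Definition deg (v : T) : nat := #|nbhd v|.

Definition no_isolated := forall v : T, exists u : T, e v u.
Definition is_leaf (v : T) : bool := deg v == 1.

Definition walk_len (u v : T) (k : nat) : Prop :=
  exists s : seq T, [/\ size s = k, path e u s & last u s = v].

Definition dist_eq (u v : T) (k : nat) : Prop :=
  walk_len u v k /\ forall j, j < k -> ~ walk_len u v j.

(* vertices totally dominated by the chosen set: D is the set of totally
   dominated vertices so far.  A vertex v is a legal move iff it totally
   dominates some vertex not yet totally dominated. *)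
Definition legal (D : {set T}) (v : T) : bool := [exists y, e v y && (y \notin D)].

(* minimum / maximum of a list (meaningful on nonempty lists) *)
Definition seqmin (s : seq nat) : nat := foldr minn (head 0 s) s.
Definition seqmax (s : seq nat) : nat := foldr maxn 0 s.

(* gval k dom D: number of further moves in the total domination game under
   optimal play, when D is the set of already totally dominated vertices and
   it is Dominator's turn iff dom = true; k is fuel (each move strictly enlarges D). *)
Fixpoint gval (k : nat) (dom : bool) (D : {set T}) : nat :=
  match k with
  | 0 => 0
  | k'.+1 =>
    if D == setT then 0 else
    let vals := [seq (gval k' (~~ dom) (D :|: nbhd v)).+1
                | v <- enum T & legal D v] in
    if dom then seqmin vals else seqmax vals
  end.

Definition gamma_tg : nat := gval #|T|.+1 true set0.

End TDG.

(* Main.v *)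
Require Import Defs.
From mathcomp Require Import all_boot.
From mathcomp Require Import zify.
Set Implicit Arguments. Unset Strict Implicit. Unset Printing Implicit Defensive.

(* Let U be the set of vertices not yet totally dominated.  A potential phi
   counts 2 for each vertex of U, 1 for each vertex that is still playable, and
   an extra 1 for each "charged" leaf: an undominated leaf whose support can
   end up with nothing else to dominate at too low a price for Staller.
   Initially phi = 3n, so it suffices that phi loses 4 per move on average.
   Dominator always has a move costing 5, unless phi >= 4|U| already, and each
   Staller move either costs 3 or has a reply bringing the total for the two
   moves to 8.  Since no two leaves are at distance 4, distinct supports with a
   common neighbour are adjacent, which limits how many supports a move can
   isolate. *)

(** * Counting by matchings, and extrema of lists *)

(** A choice of partners is injective because no [w] serves two elements. It serves to count leaves
    by their supports, or by vertices lost to those supports. *)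
Lemma card_le_matching (T : finType) (R : rel T) (S W : {set T}) :
  (forall u, u \in S -> exists2 w, w \in W & R u w) ->
  (forall u u' w, u \in S -> u' \in S -> R u w -> R u' w -> u = u') ->
  #|S| <= #|W|.
Proof.
move=> exR injR; pose f u := odflt u [pick w in W | R u w].
have fP u : u \in S -> f u \in W /\ R u (f u).
  move=> /exR [w wW Ruw]; rewrite /f; case: pickP => [w' /andP[]//|/(_ w)].
  by rewrite wW Ruw.
have /card_in_imset <- : {in S &, injective f}.
  move=> u u' uS u'S fE; apply: (injR u u' (f u)) => //.
    by case: (fP u uS).
  by rewrite fE; case: (fP u' u'S).
by apply/subset_leq_card/subsetP => _ /imsetP[u uS ->]; case: (fP u uS).
Qed.

Lemma seqmin_le (s : seq nat) n : n \in s -> seqmin s <= n.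
Proof.
rewrite /seqmin; elim: s (head 0 s) => //= m s IH b.
rewrite inE => /orP[/eqP->|/IH le]; first exact: geq_minl.
exact: leq_trans (geq_minr _ _) (le b).
Qed.

Lemma seqmax_le (s : seq nat) b : (forall n, n \in s -> n <= b) -> seqmax s <= b.
Proof.
rewrite /seqmax; elim: s => //= m s IH sb; rewrite geq_max sb ?mem_head //=.
by apply: IH => n ns; rewrite sb // inE ns orbT.
Qed.


(** * Leaves and their supports *)

Section Potential.
Variables (T : finType) (e : rel T).
Hypothesis e_sym : symmetric e.
Hypothesis e_irr : irreflexive e.
Hypothesis e_ex : no_isolated e.
Hypothesis deg_sum : forall u v, e u v -> 4 <= deg e u + deg e v.
Hypothesis no_leaf_dist4 :
  forall u v, is_leaf e u -> is_leaf e v -> ~ dist_eq e u v 4.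

Implicit Types (U W K : {set T}) (u v w x y : T).

Lemma leaf_nbr u v w : is_leaf e u -> e u v -> e u w -> w = v.
Proof.
move=> /cards1P[z zE] euv euw.
have : v \in nbhd e u by rewrite inE.
have : w \in nbhd e u by rewrite inE.
by rewrite zE !inE => /eqP-> /eqP->.
Qed.

Lemma leaf_deg u v : is_leaf e u -> e u v -> 3 <= deg e v.
Proof. by move=> /eqP du /deg_sum; rewrite du. Qed.

Lemma leaf_nonadj u v : is_leaf e u -> e u v -> ~~ is_leaf e v.
Proof. by move=> lu /(leaf_deg lu); rewrite /is_leaf; case: eqP => // ->. Qed.

(** The walk [u v w v' u'] has length 4; if the supports were distinct and nonadjacent, no shorter
    walk would exist and the leaves would be at distance exactly 4. *)
Lemma supports_common_nbr u u' v v' w :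
  is_leaf e u -> is_leaf e u' -> e u v -> e u' v' -> e v w -> e v' w ->
  v = v' \/ e v v'.
Proof.
move=> lu lu' euv eu'v' evw ev'w.
case: (eqVneq v v') => [->|nvv']; [by left | right].
apply: contraT => nevv'; case: (no_leaf_dist4 lu lu'); split.
  by exists [:: v; w; v'; u']; split=> //=; rewrite euv evw (e_sym w) ev'w e_sym eu'v'.
have nbu a : e u a -> a = v by move=> eua; exact: leaf_nbr euv eua.
have nbu' a : e a u' -> a = v' by rewrite e_sym => eua; exact: leaf_nbr eu'v' eua.
(* A walk leaves [u] through [v] and enters [u'] through [v'], so lengths 0 to 3 force in turn
   [v = v'], adjacent leaves, [v = v'], and [v] adjacent to [v']. *)
move=> j jlt [s [sz pth lst]].
case: s sz pth lst => [|a [|b [|c [|d s]]]] //= sz.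
- by move=> _ uu'; subst u'; rewrite (nbu v') // eqxx in nvv'.
- rewrite andbT => eua au'; subst a.
  by move: (leaf_nonadj lu eua); rewrite lu'.
- move=> /and3P[/nbu-> evb _] bu'; subst b.
  by rewrite (nbu' _ evb) eqxx in nvv'.
- move=> /and4P[/nbu-> evb ebc _] cu'; subst c.
  by rewrite -(nbu' _ ebc) evb in nevv'.
- by rewrite -sz in jlt.
Qed.

(** * The potential and its change under a move *)

Definition nb U x := nbhd e x :&: U.
Definition live U := [set x | nb U x != set0].
(* In the second alternative the support [v] of [u] is undominated and has only
   [u] left to dominate.  If Staller then plays [u], thereby dominating [v], no
   vertex other than [u] ceases to be playable. *)
Definition charged U :=
  [set u in U | is_leaf e u & [forall v, e u v ==> (v \notin U) ||
     (nb U v == [set u]) && [forall y, e v y && (y != u) ==> (1 < #|nb U y|)]]].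
Definition phi U := 2 * #|U| + #|live U| + #|charged U|.
(** Only these new charges cost anything: a leaf charged because its support has just been dominated
    pays for itself by ceasing to be playable. *)
Definition newbad U U' :=
  [set u in charged U' :\: charged U | [exists v in U', e u v]].

Lemma in_nb U x y : (y \in nb U x) = e x y && (y \in U).
Proof. by rewrite !inE. Qed.

Lemma in_play U x y : (y \in U :\: nbhd e x) = ~~ e x y && (y \in U).
Proof. by rewrite !inE. Qed.

Lemma nb_sub U U' x : U' \subset U -> nb U' x \subset nb U x.
Proof. exact: setIS. Qed.

Lemma nb_gt1_nonleaf U x : 1 < #|nb U x| -> ~~ is_leaf e x.
Proof.
move=> gt1; apply/negP => /eqP lx.
by have := subset_leq_card (subsetIl (nbhd e x) U); move: lx gt1; rewrite /deg /nb => ->; clear; lia.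
Qed.

Lemma charged_leaf U u : u \in charged U -> is_leaf e u /\ u \in U.
Proof. by rewrite inE => /and3P[]. Qed.

(** Each newly dominated vertex yields 2 and each vertex that ceases to be playable yields 1. A new
    charge outside [newbad] is paid by the death of its own leaf; the condition on [K] keeps that
    unit from being used twice. *)
Lemma phi_drop U U' K m :
  U' \subset U -> K \subset live U :\: live U' ->
  (forall x, x \in K -> x \in charged U' -> x \in charged U) ->
  m + #|newbad U U'| <= 2 * #|U :\: U'| + #|K| -> phi U' + m <= phi U.
Proof.
move=> sUU' sK Kch.
have cU : #|U| = #|U'| + #|U :\: U'|.
  by rewrite cardsD (setIidPr sUU') subnKC ?subset_leq_card.
have sL : live U' \subset live U.
  apply/subsetP => x; rewrite !inE -!card_gt0 => /leq_trans; apply.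
  exact/subset_leq_card/nb_sub.
have cL : #|live U| = #|live U'| + #|live U :\: live U'|.
  by rewrite cardsD (setIidPr sL) subnKC ?subset_leq_card.
pose Z := (charged U' :\: charged U) :\: newbad U U'.
have cC : #|charged U'| <= #|charged U| + (#|newbad U U'| + #|Z|).
  apply: leq_trans (leq_add (leqnn _) (leq_card_setU _ _)).
  apply: leq_trans (leq_card_setU _ _).
  apply/subset_leq_card/subsetP => u; rewrite /Z !(in_setU, in_setD) => ->.
  by case: (u \in charged U); case: (u \in newbad U U').
have sZ : Z \subset (live U :\: live U') :\: K.
  apply/subsetP => u /setDP[/setDP[uC' uNC] uNb].
  have [lu uU'] := charged_leaf uC'.
  rewrite inE; apply/andP; split; first by apply: contra uNC => uK; apply: Kch uC'.
  have [v euv] := e_ex u.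
  have vNU' : v \notin U'.
    apply: contra uNb => vU'; rewrite !inE in uC' uNC *; rewrite uC' uNC /=.
    by apply/existsP; exists v; rewrite vU'.
  rewrite !inE; apply/andP; split.
    rewrite negbK; apply/eqP/setP => x; rewrite in_nb inE.
    by case: (boolP (e u x)) => //= /(leaf_nbr lu euv) ->; exact/negbTE.
  apply/set0Pn; exists v; rewrite in_nb euv /=.
  (* Had the support been dominated already, the leaf would have been charged in [U]. *)
  apply: contraR uNC => vNU; rewrite inE lu (subsetP sUU') //=.
  by apply/forallP => x; apply/implyP => /(leaf_nbr lu euv) ->; rewrite vNU.
have := subset_leq_card sZ; rewrite cardsD (setIidPr sK).
move: (subset_leq_card sK) cU cL cC; rewrite /phi; clear; lia.
Qed.

(** The support must have lost some [w]: otherwise [nb U v] was already [[set u]], the condition on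
    [y] passes to the larger [U], and [u] was charged before. *)
Lemma newbadP U U' u : U' \subset U -> u \in newbad U U' ->
  exists v, [/\ is_leaf e u, u \in U', e u v & v \in U'] /\
   [/\ nb U' v = [set u], (forall y, e v y -> y != u -> 1 < #|nb U' y|)
     & exists w, [/\ e v w, w \in U & w \notin U']].
Proof.
move=> sUU'; rewrite !inE => /andP[/andP[uNC /and3P[uU' lu /forallP uC']] /existsP[v /andP[vU' euv]]].
exists v; split=> //.
move: (uC' v); rewrite euv vU' /= => /andP[/eqP nbv /forallP ally].
have ally' y : e v y -> y != u -> 1 < #|nb U' y|.
  by move=> evy yu; move: (ally y); rewrite evy yu.
split=> //.
have : [exists w, [&& e v w, w \in U & w \notin U']].
  apply: contraR uNC => /existsPn now; rewrite lu (subsetP sUU') //=.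
  have nbE : nb U v = [set u].
    rewrite -nbv; apply/setP => x; rewrite !in_nb; move: (now x).
    case: (e v x) => //=; case: (boolP (x \in U')) => [/(subsetP sUU')->//|].
    by case: (x \in U).
  apply/forallP => x; apply/implyP => /(leaf_nbr lu euv) ->.
  rewrite nbE eqxx; apply/orP; right; apply/forallP => y; apply/implyP => /andP[evy yu].
  by apply: leq_trans (ally' y evy yu) _; apply/subset_leq_card/nb_sub.
by case/existsP => w /and3P[? ? ?]; exists w.
Qed.

Lemma support_nonleaf u v : is_leaf e u -> e u v -> v != u.
Proof. by move=> lu euv; apply: contraL (leaf_nonadj lu euv) => /eqP->; rewrite lu. Qed.

(** Supports sharing [w] coincide or are adjacent; adjacency would put [v'] in [nb U v], making it
    the leaf [u]. *)
Lemma isolated_support U u u' v v' w :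
  is_leaf e u -> e u v -> nb U v = [set u] ->
  is_leaf e u' -> e u' v' -> v' \in U -> e v w -> e v' w -> v' = v.
Proof.
move=> lu euv nbv lu' eu'v' v'U evw ev'w.
case: (supports_common_nbr lu lu' euv eu'v' evw ev'w) => // evv'.
have : v' \in nb U v by rewrite in_nb evv'.
rewrite nbv inE => /eqP v'u; subst v'.
by move: (leaf_nonadj lu' eu'v'); rewrite lu.
Qed.

(** Each leaf is matched with a neighbour lost by its support; by [isolated_support] the lost vertex
    determines the support, hence the leaf. *)
Lemma card_newbad U U' W : U' \subset U ->
  (forall u v w, u \in newbad U U' -> e u v -> v \in U' -> e v w ->
     w \in U -> w \notin U' -> w \in W) ->
  #|newbad U U'| <= #|W|.
Proof.
move=> sUU' sW.
apply: (@card_le_matching _ (fun u w => [exists v in U', e u v && e v w])).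
  move=> u uN; have [v [[lu uU' euv vU'] [nbv _ [w [evw wU wU']]]]] := newbadP sUU' uN.
  exists w; first exact: (sW u v).
  by apply/existsP; exists v; rewrite vU' euv evw.
move=> u u' w uN u'N /existsP[v /and3P[vU' euv evw]] /existsP[v' /and3P[v'U' eu'v' ev'w]].
have [a [[lu _ eua _] [nba _ _]]] := newbadP sUU' uN.
have [a' [[lu' _ eua' _] [nba' _ _]]] := newbadP sUU' u'N.
rewrite (leaf_nbr lu euv eua) in nba; rewrite (leaf_nbr lu' eu'v' eua') in nba'.
have vv' := isolated_support lu euv nba lu' eu'v' v'U' evw ev'w.
by move: nba'; rewrite vv' nba => /set1_inj.
Qed.

(** A support that loses a neighbour to [v] is either [v], whose leaves are now dominated, or
    adjacent to [v] and so dominated itself. *)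
Lemma play_support U u v : is_leaf e u -> e u v ->
  newbad U (U :\: nbhd e v) = set0.
Proof.
move=> lu euv; apply/eqP; rewrite -subset0; apply/subsetP => u' u'N.
have [v' [[lu' _ eu'v' v'U'] [nbv' _ [w [ev'w wU wU']]]]] := newbadP (subsetDl _ _) u'N.
have evw : e v w by move: wU'; rewrite !inE wU andbT negbK.
case: (supports_common_nbr lu lu' euv eu'v' evw ev'w) => [vv'|evv'].
  have : u' \in nb (U :\: nbhd e v) v' by rewrite nbv' inE.
  by rewrite -vv' !inE; case: (e v u').
by move: v'U'; rewrite !inE evv'.
Qed.

Lemma setDnb U x : U :\: (U :\: nbhd e x) = nb U x.
Proof. by apply/setP => y; rewrite !inE; case: (y \in U); case: (e x y). Qed.

Lemma nb_played U x : nb (U :\: nbhd e x) x = set0.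
Proof. by apply/setP => y; rewrite !inE; case: (e x y). Qed.

Lemma play_dies U x : x \in live U -> [set x] \subset live U :\: live (U :\: nbhd e x).
Proof. by move=> xL; rewrite sub1set inE xL andbT inE nb_played eqxx. Qed.

(** * Dominator's moves *)

(** As no vertex has two undominated neighbours, [#|live U|] is at least the degree sum over [U].
    Only leaves fall short of degree 2; the deficit is covered by a charge or else by the support,
    of degree at least 3. *)
Lemma final_phase U : (forall x, #|nb U x| <= 1) -> 4 * #|U| <= phi U.
Proof.
move=> le1.
(* The leaves in [B] carry no charge, so their supports, forming [V], are undominated and have a
   unit of degree to spare. *)
pose B := [set t in U | is_leaf e t & t \notin charged U].
pose V := [set v in U | [exists t in B, e t v]].
have BV : #|B| <= #|V|.
  apply: (@card_le_matching _ e) => [u uB|u u' v uB u'B euv eu'v].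
    move: (uB); rewrite inE => /and3P[uU lu uNC]; have [v euv] := e_ex u.
    exists v => //; rewrite inE; apply/andP; split; last first.
      by apply/existsP; exists u; rewrite uB.
    apply: contraR uNC => vU; rewrite inE uU lu /=.
    by apply/forallP => x; apply/implyP => /(leaf_nbr lu euv) ->; rewrite vU.
  move: uB u'B; rewrite !inE => /and3P[uU _ _] /and3P[u'U _ _].
  have : [set u; u'] \subset nb U v.
    by apply/subsetP => x /set2P[]->; rewrite in_nb e_sym ?euv ?eu'v.
  move=> /subset_leq_card; rewrite cards2; case: eqP => //= _.
  by have := le1 v; clear; lia.
have cnt W : W \subset U -> \sum_(t in U) (t \in W : nat) = #|W|.
  move=> sWU; rewrite -[in RHS](setIidPr sWU) -sum1_card big_mkcond [RHS]big_mkcond.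
  by apply: eq_bigr => t _; rewrite inE; case: (t \in U); case: (t \in W).
have sumL : \sum_(t in U) deg e t <= #|live U|.
  have -> : \sum_(t in U) deg e t = \sum_x #|nb U x|.
    transitivity (\sum_(t in U) \sum_x (e t x : nat)).
      apply: eq_bigr => t _; rewrite /deg -sum1_card big_mkcond.
      by apply: eq_bigr => x _; rewrite inE; case: (e t x).
    rewrite exchange_big; apply: eq_bigr => x _.
    rewrite -sum1_card big_mkcond [RHS]big_mkcond; apply: eq_bigr => t _.
    by rewrite in_nb e_sym andbC; case: (t \in U); case: (e x t).
  rewrite -sum1_card [X in _ <= X]big_mkcond; apply: leq_sum => x _.
  by rewrite inE -card_gt0; have := le1 x; case: #|nb U x| => [|[]].
have key : \sum_(t in U) (2 + (t \in V)) <=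
           \sum_(t in U) (deg e t + (t \in charged U) + (t \in B)).
  apply: leq_sum => t tU.
  have dt : 0 < deg e t by have [v etv] := e_ex t; apply/card_gt0P; exists v; rewrite inE.
  have [tV|tV] := boolP (t \in V).
    move: tV; rewrite inE => /andP[_ /existsP[u /andP[]]].
    by rewrite inE => /and3P[_ lu _] /(leaf_deg lu); clear; lia.
  have [lt|lt] := boolP (is_leaf e t); last by move: lt dt; rewrite /is_leaf; clear; lia.
  by move: dt; rewrite [t \in B]inE tU lt; case: (t \in charged U); clear; lia.
move: key; rewrite !big_split /= !cnt ?sum_nat_const; first by move: sumL BV; rewrite /phi; clear; lia.
- by apply/subsetP => t; rewrite inE => /andP[].
- by apply/subsetP => t /charged_leaf[].
- by apply/subsetP => t; rewrite inE => /andP[].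
Qed.

(** Dominating two vertices and ending the played one yields 5 when no costly charge appears. Among
    vertices with two undominated neighbours, a support of an undominated leaf is preferred; if
    there is no such vertex at all, [final_phase] applies. *)
Lemma dominator_move U :
  4 * #|U| <= phi U \/
  exists2 x, x \in live U & phi (U :\: nbhd e x) + 5 <= phi U.
Proof.
have drop x : 1 < #|nb U x| -> newbad U (U :\: nbhd e x) = set0 ->
    x \in live U /\ phi (U :\: nbhd e x) + 5 <= phi U.
  move=> gt1 nb0; have xL : x \in live U by rewrite inE -card_gt0; exact: ltnW.
  split=> //.
  have xNC y : y \in [set x] -> y \in charged (U :\: nbhd e x) -> y \in charged U.
    by move=> /set1P-> /charged_leaf[lx _]; move: (nb_gt1_nonleaf gt1); rewrite lx.
  apply: (phi_drop (subsetDl _ _) (play_dies xL) xNC).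
  by rewrite nb0 cards0 cards1 setDnb; move: gt1; clear; lia.
have [/existsP[v /andP[gt1 /existsP[u /and3P[uU lu euv]]]]|noS] :=
  boolP [exists v, (1 < #|nb U v|) && [exists u in U, is_leaf e u && e u v]].
  by right; exists v; case: (drop v gt1 (play_support U lu euv)).
have [/existsP[x gt1]|le1] := boolP [exists x, 1 < #|nb U x|]; last first.
  by left; apply: final_phase => x; move/existsPn: le1 => /(_ x); rewrite -leqNgt.
right; exists x; case: (drop x gt1) => //.
(* Both remaining goals ask that [newbad] be empty: the support of such a leaf would have had the
   leaf and the lost [w] undominated, against [noS]. *)
all: apply/eqP; rewrite -subset0; apply/subsetP => u uN.
all: have [v [[lu uU' euv _] [_ _ [w [evw wU wU']]]]] := newbadP (subsetDl _ _) uN.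
all: have uU := subsetP (subsetDl _ _) _ uU'.
all: move/existsPn: noS => /(_ v) /negP[]; apply/andP; split; last first.
all: try by apply/existsP; exists u; rewrite uU lu.
all: apply: leq_trans (_ : #|[set u; w]| <= _).
all: try by rewrite cards2; case: eqP uU' wU' => // -> ->.
all: by apply/subset_leq_card/subsetP => y /set2P[]->; rewrite in_nb ?evw // e_sym euv.
Qed.

(** * Staller's moves and Dominator's replies *)

Lemma staller_leaf_move U x v :
  is_leaf e x -> e x v -> x \in U -> v \in U ->
  phi (U :\: nbhd e x) + 3 <= phi U \/
  exists2 y, y \in live (U :\: nbhd e x) &
    phi (U :\: nbhd e x :\: nbhd e y) + 8 <= phi U.
Proof.
move=> lx exv xU vU; set U' := U :\: nbhd e x.
have exE y : e x y = (y == v) by apply/idP/eqP => [/(leaf_nbr lx exv)|->].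
have xv : x != v by rewrite eq_sym (support_nonleaf lx exv).
have xL : x \in live U by rewrite inE; apply/set0Pn; exists v; rewrite in_nb exv.
have sU' : U' \subset U := subsetDl _ _.
have xnv : x \in nb U v by rewrite in_nb e_sym exv.
have cU' : 0 < #|U :\: U'|.
  by apply/card_gt0P; exists v; rewrite setDnb in_nb exv.
have irr := e_irr v.
have [gt1|le1] := ltnP 1 #|nb U v|.
  (* Three or more vertices are dominated, [v] by [x] and the others by the reply [v], and both [x]
     and [v] cease to be playable: 6 + 2. *)
  right; exists v.
    by rewrite inE; apply/set0Pn; exists x; rewrite in_nb e_sym exv in_play exE xv.
  set U2 := U' :\: nbhd e v.
  have sU2 : U2 \subset U := subset_trans (subsetDl _ _) sU'.
  (* A support losing [v] is adjacent to [v]; one losing a neighbour of [v] equals [v] or is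
     adjacent to it. Either way it is dominated. *)
  have n0 : newbad U U2 = set0.
    apply/eqP; rewrite -subset0; apply/subsetP => u uN.
    have [v' [[lu uU2 euv' v'U2] [nbv' _ [w [ev'w wU wU2]]]]] := newbadP sU2 uN.
    have vNU2 : v \notin U2 by rewrite !in_play exE eqxx andbF.
    have nvv' : ~~ e v v' by move: v'U2; rewrite in_play => /andP[].
    move: wU2; rewrite !in_play exE wU andbT negb_and !negbK => /orP[evw|/eqP wv].
      case: (supports_common_nbr lx lu exv euv' evw ev'w) => [vv'|evv'].
        by rewrite vv' v'U2 in vNU2.
      by rewrite evv' in nvv'.
    by rewrite e_sym -wv ev'w in nvv'.
  have nU2v : nb U2 v = set0 by exact: nb_played.
  have sK : [set x; v] \subset live U :\: live U2.
    apply/subsetP => y /set2P[]->; rewrite inE; apply/andP; split=> //.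
    + rewrite inE negbK; apply/eqP/setP => z; rewrite in_nb in_set0.
      by case: (boolP (e x z)) => //= /(leaf_nbr lx exv) ->; rewrite !inE exv andbF.
    + by rewrite inE nU2v eqxx.
    + by rewrite inE -card_gt0; exact: ltnW.
  have Kch y : y \in [set x; v] -> y \in charged U2 -> y \in charged U.
    move=> /set2P[]-> /charged_leaf[].
      by move=> _; rewrite !inE e_sym exv.
    by move=> lv; move: (leaf_nonadj lx exv); rewrite lv.
  have c3 : 3 <= #|U :\: U2|.
    have -> : U :\: U2 = v |: nb U v.
      apply/setP => y; rewrite in_setU1 in_nb in_setD !in_play exE.
      case: (eqVneq y v) => [->|_] /=; first by rewrite vU andbF.
      by case: (y \in U); case: (e v y).
    by rewrite cardsU1 in_nb irr; move: gt1; clear; lia.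
  by apply: (phi_drop sU2 sK Kch); rewrite n0 cards0 cards2 xv; move: c3; clear; lia.
left.
have nbv : nb U v = [set x].
  by apply/esym/eqP; rewrite eqEcard sub1set xnv cards1.
have n0 : newbad U U' = set0.
  apply/eqP; rewrite -subset0; apply/subsetP => u uN.
  have [v' [[lu uU' euv' v'U'] [nbv' _ [w [ev'w wU wU']]]]] := newbadP sU' uN.
  have wv : w = v by move: wU'; rewrite in_play exE wU andbT negbK => /eqP.
  have : v' \in nb U v by rewrite in_nb e_sym -wv ev'w (subsetP sU').
  rewrite nbv inE => /eqP v'x; subst v'.
  by move: (leaf_nonadj lu euv'); rewrite lx.
have [xC|xNC] := boolP (x \in charged U).
  have Kch y : y \in [set x] -> y \in charged U' -> y \in charged U by move=> /set1P->.
  by apply: (phi_drop sU' (play_dies xL) Kch); rewrite n0 cards0 cards1; move: cU'; clear; lia.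
(* The death of [x] may have to pay for its own new charge, so the third unit comes from a [y] with
   only [v] left, which exists because [x] was not charged. *)
have [y [evy yx yle]] : exists y, [/\ e v y, y != x & #|nb U y| <= 1].
  have : [exists y, [&& e v y, y != x & #|nb U y| <= 1]].
    apply: contraR xNC => /existsPn noy; rewrite inE xU lx /=.
    apply/forallP => z; apply/implyP => /(leaf_nbr lx exv) ->.
    rewrite nbv eqxx; apply/orP; right; apply/forallP => y; apply/implyP => /andP[evy yx].
    by rewrite ltnNge; apply: contra (noy y) => le; rewrite evy yx.
  by case/existsP => y /and3P[? ? ?]; exists y.
have nby : nb U y = [set v].
  by apply/esym/eqP; rewrite eqEcard sub1set in_nb e_sym evy vU cards1.
have sK : [set y] \subset live U :\: live U'.
  rewrite sub1set !inE negbK nby; apply/andP; split; last by apply/set0Pn; exists v; rewrite inE.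
  apply/eqP/setP => z; rewrite in_nb in_play in_set0 exE.
  by have := in_nb U y z; rewrite nby inE; case: (z == v); rewrite ?andbF // => <-.
have Kch z : z \in [set y] -> z \in charged U' -> z \in charged U.
  move=> /set1P-> /charged_leaf[_ /(subsetP sU') yU].
  have : y \in nb U v by rewrite in_nb evy.
  by rewrite nbv inE (negbTE yx).
by apply: (phi_drop sU' sK Kch); rewrite n0 cards0 cards1; move: cU'; clear; lia.
Qed.

(** If [x] has [d] undominated neighbours, the loss is at least [2d + 1] less at most [d] new
    charges. This is below 3 only if [d = 1] and one leaf becomes newly charged; that charge then
    provides a strong reply near its support. *)
Lemma staller_move U x : x \in live U ->
  phi (U :\: nbhd e x) + 3 <= phi U \/
  exists2 y, y \in live (U :\: nbhd e x) &
    phi (U :\: nbhd e x :\: nbhd e y) + 8 <= phi U.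
Proof.
move=> xL; set U' := U :\: nbhd e x.
have sU' : U' \subset U := subsetDl _ _.
have cU' : #|U :\: U'| = #|nb U x| by rewrite setDnb.
have nbx0 : nb U' x = set0 := nb_played U x.
have [xbad|xok] := boolP (x \in charged U' :\: charged U).
  have /setDP[/charged_leaf[lx xU'] xNC] := xbad.
  have [v exv] := e_ex x; apply: (staller_leaf_move lx exv (subsetP sU' _ xU')).
  move: xL; rewrite inE => /set0Pn[z]; rewrite in_nb => /andP[exz].
  by rewrite (leaf_nbr lx exv exz).
have xC (V : {set T}) : V \subset U' -> x \in charged V -> x \in charged U.
  move=> sV xCV; move: xok; rewrite inE negb_and negbK => /orP[//|/negP[]].
  have [lx xV] := charged_leaf xCV; have [v exv] := e_ex x.
  rewrite inE (subsetP sV) //= lx; apply/forallP => z; apply/implyP => exz.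
  by rewrite in_play exz.
have Kx y : y \in [set x] -> y \in charged U' -> y \in charged U.
  by move=> /set1P->; apply: xC.
have d0 : 0 < #|nb U x| by rewrite card_gt0; rewrite inE in xL.
have cN : #|newbad U U'| <= #|nb U x|.
  apply: card_newbad => // u v w _ _ _ _ wU; rewrite in_play in_nb wU !andbT.
  by rewrite negbK.
have drop m : m + #|newbad U U'| <= 2 * #|nb U x| + 1 -> phi U' + m <= phi U.
  by move=> le; apply: (phi_drop sU' (play_dies xL) Kx); rewrite cards1 cU'.
have [d2|d1] := ltnP 1 #|nb U x|; first by left; apply: drop; move: d2 cN; clear; lia.
have [nb0|/set0Pn[u uN]] := eqVneq (newbad U U') set0.
  by left; apply: drop; move: d0; rewrite nb0 cards0; clear; lia.
have [v [[lu uU' euv vU'] [nbv big [w [evw wU wU']]]]] := newbadP sU' uN.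
have nbxE : nb U x = [set w].
  apply/esym/eqP; rewrite eqEcard sub1set cards1 d1 andbT in_nb wU andbT.
  by move: wU'; rewrite in_play wU andbT negbK.
have U'E z : (z \in U') = (z != w) && (z \in U).
  rewrite in_play; have := in_nb U x z; rewrite nbxE inE => ->.
  by case: (e x z); case: (z \in U).
have onlyv u' v' : is_leaf e u' -> e u' v' -> v' \in U' -> e v' w -> v' = v.
  by move=> lu' euv' v'U' ev'w; exact: (isolated_support lu euv nbv lu' euv' v'U' evw ev'w).
have nbrv v' : v' \in U' -> e v v' -> v' = u.
  by move=> v'U' evv'; apply/set1P; rewrite -nbv in_nb evv'.
(* The vertices [w] and [nb U' y] yield [2 * (#|nb U' y| + 1)], the deaths of [x] and [y] yield 2,
   and the new charges must leave 8. *)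
have reply y : 1 < #|nb U' y| -> #|newbad U (U' :\: nbhd e y)| + 4 <= 2 * #|nb U' y| ->
    y \in live U' /\ phi (U' :\: nbhd e y) + 8 <= phi U.
  move=> y2 small; have yL : y \in live U' by rewrite inE -card_gt0; exact: ltnW.
  split=> //; set U2 := U' :\: nbhd e y in small *.
  have sU2' : U2 \subset U' := subsetDl _ _.
  have sU2 : U2 \subset U := subset_trans sU2' sU'.
  have xy : x != y by apply: contraTneq yL => <-; rewrite inE nbx0 eqxx.
  have sK : [set x; y] \subset live U :\: live U2.
    apply/subsetP => z /set2P[]->; rewrite inE.
      by rewrite xL andbT inE negbK -subset0 -nbx0 nb_sub.
    rewrite inE nb_played eqxx inE -card_gt0.
    by apply: leq_trans (ltnW y2) _; apply/subset_leq_card/nb_sub.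
  have Kch z : z \in [set x; y] -> z \in charged U2 -> z \in charged U.
    move=> /set2P[]->; first exact: xC.
    by move=> /charged_leaf[ly _]; move: (nb_gt1_nonleaf y2); rewrite ly.
  have c3 : #|U :\: U2| = #|nb U' y|.+1.
    have -> : U :\: U2 = w |: nb U' y.
      apply/setP => z; rewrite in_setU1 in_nb in_setD in_play U'E.
      case: (eqVneq z w) => [->|_] /=; first by rewrite wU andbF.
      by case: (z \in U); case: (e y z).
    by rewrite cardsU1 in_nb U'E eqxx andbF.
  by apply: (phi_drop sU2 sK Kch); rewrite cards2 xy c3; move: small; clear; lia.
right.
have [y evy yu] : exists2 y, e v y & y != u.
  have : 1 < #|nbhd e v :\ u|.
    have := leaf_deg lu euv; rewrite /deg (cardsD1 u) inE e_sym euv; clear; lia.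
  by case/card_gt1P => y [z [/setD1P[yu]]]; rewrite inE => evy _ _; exists y.
(* The neighbour condition in [charged] is what makes the reply [y] dominate two vertices. *)
have y2 := big y evy yu.
have vy : v \in nb U' y by rewrite in_nb e_sym evy.
pose U2 := U' :\: nbhd e y.
have sU2' : U2 \subset U' := subsetDl _ _.
have sU2 : U2 \subset U := subset_trans sU2' sU'.
have vNU2 : v \notin U2 by rewrite in_play e_sym evy.
(* Dominator answers with [y], which dominates [v].  If this isolates another
   support [v'] and costs too little, he plays [v'] instead: that leaves [y]
   with only [v] to dominate, so the leaf [u] is not charged. *)
have newW u' v' z : u' \in newbad U U2 -> e u' v' -> v' \in U2 -> e v' z ->
    z \in U -> z \notin U2 -> z \in nb U' y :\ v.
  move=> u'N eu'v' v'U2 ev'z zU zU2.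
  have v'U' := subsetP sU2' _ v'U2.
  have [v0 [[lu' _ _ _] _]] := newbadP sU2 u'N.
  have zw : z != w.
    apply: contraNneq vNU2 => zw; rewrite -(onlyv u' v') //.
    by rewrite -zw.
  rewrite in_setD1 in_nb U'E zw zU /=; apply/andP; split.
    apply: contraTneq lu => zv; rewrite zv in ev'z.
    rewrite -(nbrv v') //; first exact: leaf_nonadj eu'v'.
    by rewrite e_sym.
  by move: zU2; rewrite in_play U'E zw zU /= andbT negbK => ->.
have cN2 : #|newbad U U2| <= #|nb U' y|.-1.
  by apply: leq_trans (card_newbad sU2 newW) _; rewrite (cardsD1 v (nb U' y)) vy.
have [small|large] := leqP (#|newbad U U2| + 4) (2 * #|nb U' y|).
  by exists y; case: (reply y y2 small).
(* With [n] for [#|nb U' y|], at most [n - 1] new charges leave enough once [n >= 3]. *)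
have nby2 : #|nb U' y| = 2 by move: large cN2 y2; clear; lia.
have /card_gt0P[u' u'N] : 0 < #|newbad U U2| by move: large y2; clear; lia.
have [v' [[lu' u'U2 eu'v' v'U2] [nbv' _ [z [ev'z zU zU2]]]]] := newbadP sU2 u'N.
have zW := newW _ _ _ u'N eu'v' v'U2 ev'z zU zU2.
have v'U' := subsetP sU2' _ v'U2.
have u'U' := subsetP sU2' _ u'U2.
have nbyE : nb U' y = [set v; z].
  move: zW; rewrite inE => /andP[]; rewrite inE => zv zy.
  apply/esym/eqP; rewrite eqEcard cards2 eq_sym zv nby2 andbT.
  by apply/subsetP => a /set2P[]->.
have [zU' eyz] : z \in U' /\ e y z.
  by move: zW; rewrite in_setD1 in_nb => /and3P[].
have zu' : z != u' by apply: contraNneq zU2 => ->.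
have nbv'2 : 1 < #|nb U' v'|.
  apply: leq_trans (_ : #|[set z; u']| <= _); first by rewrite cards2 zu'.
  by apply/subset_leq_card/subsetP => a /set2P[]->; rewrite in_nb ?ev'z // e_sym eu'v'.
suff /(reply v' nbv'2)[] : #|newbad U (U' :\: nbhd e v')| + 4 <= 2 * #|nb U' v'| by exists v'.
suff -> : newbad U (U' :\: nbhd e v') = set0 by rewrite cards0; move: nbv'2; clear; lia.
apply/eqP; rewrite -subset0; apply/subsetP => a aN.
set U3 := U' :\: nbhd e v' in aN.
have sU3' : U3 \subset U' := subsetDl _ _.
have sU3 : U3 \subset U := subset_trans sU3' sU'.
have [b [[la aU3 eab bU3] [nbb bigb [t [ebt tU tU3]]]]] := newbadP sU3 aN.
have bU' := subsetP sU3' _ bU3.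
have [tw|tw] := eqVneq t w.
  have bv : b = v by apply: onlyv la eab bU' _; rewrite -tw.
  have au : a = u.
    have : a \in nb U3 b by rewrite nbb inE.
    by rewrite bv in_nb => /andP[eva aU3']; apply: nbrv => //; exact: (subsetP sU3').
  have := bigb y; rewrite bv au => /(_ evy yu); rewrite ltnNge => /negP[].
  rewrite -(cards1 v); apply/subset_leq_card/subsetP => c; rewrite in_nb => /andP[eyc cU3].
  have : c \in nb U' y by rewrite in_nb eyc (subsetP sU3').
  rewrite nbyE => /set2P[->|cz]; first by rewrite inE.
  by move: cU3; rewrite cz in_play ev'z.
(* Now [t] is a neighbour of [v'], so [b] is [v'], with nothing left to dominate, or is adjacent to
   [v'] and dominated. *)
have ev't : e v' t by move: tU3; rewrite in_play U'E tw tU /= andbT negbK.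
case: (supports_common_nbr lu' la eu'v' eab ev't ebt) => [v'b|ev'b].
  have : a \in nb U3 b by rewrite nbb inE.
  by rewrite -v'b nb_played inE.
by move: bU3; rewrite in_play ev'b.
Qed.

(** * From the potential to the game value *)

(** Every legal move dominates a new vertex. This settles positions with [4 * #|U| <= phi U],
    however play continues. *)
Lemma gval_le_card k dom (D : {set T}) : gval e k dom D <= #|~: D|.
Proof.
elim: k dom D => [|k IH] dom D //=; case: eqP => // _.
have step v : legal e D v -> (gval e k (~~ dom) (D :|: nbhd e v)).+1 <= #|~: D|.
  move=> /existsP[y /andP[evy yD]]; apply: leq_ltn_trans (IH _ _) _.
  apply: proper_card; apply/properP; split.
    by rewrite setCS subsetUl.
  by exists y; rewrite !inE ?yD // negbK evy orbT.
have les : forall n, n \in [seq (gval e k (~~ dom) (D :|: nbhd e v)).+1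
    | v <- enum T & legal e D v] -> n <= #|~: D|.
  by move=> n /mapP[v]; rewrite mem_filter => /andP[/step lev _] ->.
case: dom {step} les => les; last exact: seqmax_le.
(* Without a legal move [seqmin] takes its default value 0. *)
case E : [seq _ | v <- _ & _] => [//|n t].
apply: leq_trans (seqmin_le (mem_head n t)) _.
by apply: les; rewrite E mem_head.
Qed.

Lemma legal_live (D : {set T}) v : legal e D v = (v \in live (~: D)).
Proof.
rewrite inE; apply/existsP/set0Pn => [[y /andP[evy yD]]|[y]].
  by exists y; rewrite in_nb evy inE.
by rewrite in_nb inE => /andP[evy yD]; exists y; rewrite evy.
Qed.

Lemma undominated_play (D : {set T}) v : ~: (D :|: nbhd e v) = ~: D :\: nbhd e v.
Proof. by rewrite setCU setDE. Qed.

Lemma gval_dominator k (D : {set T}) v : legal e D v ->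
  gval e k.+1 true D <= (gval e k false (D :|: nbhd e v)).+1.
Proof.
move=> lv /=; case: eqP => // _; apply/seqmin_le/mapP.
by exists v => //; rewrite mem_filter lv mem_enum.
Qed.

Lemma gval_staller k (D : {set T}) b :
  (forall v, legal e D v -> (gval e k true (D :|: nbhd e v)).+1 <= b) ->
  gval e k.+1 false D <= b.
Proof.
move=> leb /=; case: eqP => // _; apply: seqmax_le => n /mapP[v].
by rewrite mem_filter => /andP[/leb lev _] ->.
Qed.

(** The [+ 1] on Staller's turn is the surplus of Dominator's 5 over 4; it makes up for a Staller
    move losing only 3. Induction is strong because a move with its reply uses two units of fuel. *)
Lemma gval_phi k (D : {set T}) :
  4 * gval e k true D <= phi (~: D) /\ 4 * gval e k false D <= phi (~: D) + 1.
Proof.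
elim/ltn_ind: k D => -[//|k] IH D; split.
  have [le4|[v vL drop]] := dominator_move (~: D).
    by apply: leq_trans le4; rewrite leq_mul2l gval_le_card.
  rewrite -legal_live in vL.
  have [_] := IH k (ltnSn k) (D :|: nbhd e v); rewrite undominated_play.
  move: (gval_dominator k vL) drop; clear; lia.
(* Rounding down gives a bound on the value itself, as [gval_staller] requires. *)
have [b bE] : exists b, b = (phi (~: D) + 1) %/ 4 by eexists.
suff : gval e k.+1 false D <= b by rewrite bE; clear; lia.
apply: gval_staller => v vL; have := vL; rewrite legal_live => /staller_move.
rewrite -undominated_play => -[drop|[y]].
  have [le4 _] := IH k (ltnSn k) (D :|: nbhd e v).
  by rewrite bE; move: drop le4; clear; lia.
rewrite -legal_live -undominated_play => yL drop.
(* Fuel may run out before the reply; then only one move is counted. *)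
case: k IH => [|k] IH; first by rewrite bE /=; move: drop; clear; lia.
have [_ le4] := IH k (leqnSn _) (D :|: nbhd e v :|: nbhd e y).
by rewrite bE; move: (gval_dominator k yL) drop le4; clear; lia.
Qed.

(** No leaf is charged initially: its support is undominated and has at least three undominated
    neighbours. *)
Lemma phi_start : phi setT = 3 * #|T|.
Proof.
have -> : phi setT = 2 * #|[set: T]| + #|[set: T]| + #|@set0 T|.
  congr (_ + _ + _); congr #|pred_of_set _|; apply/setP => x; rewrite [RHS]inE.
    by rewrite inE; have [y exy] := e_ex x; apply/set0Pn; exists y; rewrite in_nb exy inE.
  apply/negP; rewrite inE => /and3P[_ lx /forallP ch].
  have [v exv] := e_ex x; move: (ch v); rewrite exv inE /= => /andP[/eqP nbv _].
  have := leaf_deg lx exv.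
  by rewrite /deg -(setIT (nbhd e v)) -/(nb setT v) nbv cards1.
rewrite cardsT cards0; clear; lia.
Qed.

End Potential.

Theorem theorem2 (T : finType) (e : rel T) :
  simple_graph e ->
  no_isolated e ->
  (forall u v : T, e u v -> 4 <= deg e u + deg e v) ->
  (forall u v : T, is_leaf e u -> is_leaf e v -> ~ dist_eq e u v 4) ->
  4 * gamma_tg e <= 3 * #|T|.
Proof.
move=> [e_sym e_irr] e_ex deg_sum no_leaf_dist4.
have [start _] := gval_phi e_sym e_irr e_ex deg_sum no_leaf_dist4 #|T|.+1 set0.
by rewrite -(phi_start e_ex deg_sum) -setC0.
Qed.
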